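(* Let $n\ge 1$ be an integer and fix the constant $c>0$ in the definition of $\mathcal{S}_{n,2}^*(\mathbb{Z};H)$ given in the context. Then there are constants $C',C''>0$ and $H_0\geq 2$ depending only on $n$ and $c$ such that for all real $H\ge H_0$ $$C'\,H^{(n^2+n)/2}\le \#\mathcal{S}_{n,2}^*(\mathbb{Z};H)\le C''\,H^{n^2}(\log H)^{2+n}.$$
   Context: For a matrix $A=(a_{ij})$ with integer entries, $\mathcal{H}(A)$ is the multiplicative height of the projective point $(1:a_{11}:\cdots:a_{nn})$, i.e. $\mathcal{H}(A)=\max(1,\max_{i,j}|a_{ij}|)$. $\mathcal{S}_n(\mathbb{Z};H)$ is the set of symmetric (hence diagonalizable) $(n\times n)$-matrices $A$ with integer entries, $\det A\ne 0$ and $\mathcal{H}(A)\le cH$, where $c>0$ is a fixed constant (the paper writes $\mathcal{H}(A)\ll H$). A pair $(A,B)$ of invertible matrices is multiplicatively dependent if there are integers $(k,l)\ne(0,0)$ with $A^kB^l=I_n$. A matrix $A$ is a root of the identity matrix if $A^k=I_n$ for some integer $k>0$. $\mathcal{S}_{n,2}^*(\mathbb{Z};H)$ is the set of multiplicatively dependent pairs $(A,B)$ with $A,B\in\mathcal{S}_n(\mathbb{Z};H)$ such that neither $A$ nor $B$ is a root of the identity matrix. *)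

(* Defs.v *)
From HB Require Import structures.
From mathcomp Require Import all_boot all_order all_algebra.
From mathcomp Require Import finmap.
From mathcomp Require Import boolp classical_sets cardinality.
From mathcomp Require Import reals.

Set Implicit Arguments.
Unset Strict Implicit.
Unset Printing Implicit Defensive.

Import Order.TTheory GRing.Theory Num.Theory.

Local Open Scope classical_set_scope.
Local Open Scope ring_scope.

(** Square matrices have size [n.+1], so that every size >= 1 is covered and
    ['M[rat]_n.+1] carries the unit-ring structure giving integer powers. *)

Definition mxheight m n (A : 'M[int]_(m, n)) : nat :=
  maxn 1 (\max_i \max_j `|A i j|)%N.

Definition sym_mxs (R : realType) (n : nat) (c H : R) : set 'M[int]_n.+1 :=
  [set A | [/\ A^T = A, \det A != 0 & (mxheight A)%:R <= c * H]].

(** Negative powers of an integer matrix of nonzero determinant need not be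
    integral, so the relation is stated over the rationals. *)
Definition mul_dependent (n : nat) (A B : 'M[int]_n.+1) : Prop :=
  exists k l : int, (k, l) != (0, 0) /\
    (map_mx intr A : 'M[rat]_n.+1) ^ k * (map_mx intr B : 'M[rat]_n.+1) ^ l = 1.

Definition root_of_identity (n : nat) (A : 'M[int]_n.+1) : Prop :=
  exists2 k : nat, (0 < k)%N & A ^+ k = 1.

Definition sym_dep_pairs (R : realType) (n : nat) (c H : R) :
    set ('M[int]_n.+1 * 'M[int]_n.+1) :=
  [set AB | [/\ sym_mxs c H AB.1, sym_mxs c H AB.2,
                mul_dependent AB.1 AB.2,
                ~ root_of_identity AB.1 & ~ root_of_identity AB.2]].

(** [fset_set] sends an infinite set to [fset0]; the sets counted here are
    finite, their entries being integers bounded by [c * H]. *)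
Definition num_sym_dep_pairs (R : realType) (n : nat) (c H : R) : nat :=
  #|` fset_set (@sym_dep_pairs R n c H)|%fset.

(* Main.v *)
Require Import Defs.
From HB Require Import structures.
From mathcomp Require Import all_boot all_order all_algebra.
From mathcomp Require Import finmap.
From mathcomp Require Import boolp classical_sets cardinality.
From mathcomp Require Import reals sequences exp.
From mathcomp Require Import complex.
From mathcomp Require Import zify ring lra.

(** Why the theorem holds, with N = n.+1 the size of the matrices.

    Lower bound: the pairs (A, A) are dependent, and A is neither singular nor
    a root of the identity as soon as det A is 2 modulo 5, which holds on a
    whole coset of 5 times the lattice of symmetric integer matrices.

    Upper bound.  For symmetric B with off-diagonal entries given, the diagonal
    entries of B^2 determine the diagonal of B up to signs.  Thus a pair (A, B)
    is determined by the upper triangle of A, the strict lower triangle of B,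
    N signs and B^2: about H^(N^2) choices times the number of squares B^2
    that can occur for a given A ([size_dep_pairs_le]).  It remains to see that
    this last number is O(log H) ([count_squares]).

    The relation A^k B^l = 1 passes to the positive definite matrices A^2 and
    B^2.  A positive definite matrix has a single positive definite l-th root,
    so in an eigenbasis U of A^2, with eigenvalues p_i, the matrix B^2 is also
    diagonal, with eigenvalues p_i^r for a rational r ([dependent_exponent]).
    In particular all the squares B^2 commute, and B^2 is determined by r.

    If |det A| > 1, take a prime q dividing det A: the q-adic valuation of
    det B is r times that of det A, hence determines r, and it is O(log H)
    because det B is a nonzero integer of polynomial size.

    If |det A| = 1, all the squares are unimodular.  For two of them with
    exponents r < r', the quotient X Y^-1 is a positive definite integer
    matrix of determinant 1 other than the identity, so by the inequality
    of arithmetic and geometric means its trace exceeds N, and being an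
    integer is at least N + 1; its largest eigenvalue p_a^(r' - r) is then
    at least (N + 1) / N ([unimodular_gap]).  So the values p_a^r, which lie
    between two powers of H, grow geometrically, and there are O(log H)
    of them. *)

Set Implicit Arguments.
Unset Strict Implicit.
Unset Printing Implicit Defensive.

Import Order.TTheory GRing.Theory Num.Theory.

Local Open Scope ring_scope.

(** * Matrices diagonal in a common basis *)

Lemma det_expr (T : comPzRingType) n (M : 'M[T]_n.+1) k :
  \det (M ^+ k) = \det M ^+ k.
Proof.
elim: k => [|k IH]; first by rewrite !expr0 det1.
by rewrite !exprS -mulmxE det_mulmx IH.
Qed.

Section UnitRingConj.
Variable T : unitRingType.
Implicit Types a b u : T.

Lemma conjrM a b u : u \is a GRing.unit ->
  (u^-1 * a * u) * (u^-1 * b * u) = u^-1 * (a * b) * u.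
Proof. by move=> uu; rewrite !mulrA mulrK. Qed.

(** Turns an equality between conjugates by u and by v into an intertwining
    relation, which for diagonal a and b can be read entry by entry. *)
Lemma conjr_eq a b u v : u \is a GRing.unit -> v \is a GRing.unit ->
  (u^-1 * a * u = v^-1 * b * v) <-> (a * (u / v) = u / v * b).
Proof.
move=> uu uv; split=> [e|e].
  have : u * (u^-1 * a * u) / v = u * (v^-1 * b * v) / v by rewrite e.
  by rewrite !mulrA mulrV // mul1r mulrK.
have : u^-1 * (a * (u / v)) * v = u^-1 * (u / v * b) * v by rewrite e.
by rewrite !mulrA mulrVK // mulVr // mul1r.
Qed.

Lemma invr_unique a b : a * b = 1 -> b * a = 1 -> a^-1 = b.
Proof.
move=> ab ba; have ua : a \is a GRing.unit by apply/unitrP; exists b.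
by rewrite -[a^-1]mulr1 -ab mulKr.
Qed.

End UnitRingConj.

Lemma map_intr_inj (F : numDomainType) n :
  injective (@map_mx int F intr n.+1 n.+1).
Proof.
by move=> X Y /matrixP e; apply/matrixP=> i j; have := e i j;
  rewrite !mxE => /intr_inj.
Qed.

Section ConjDiag.
Variables (R : realType) (n : nat).
Implicit Types (U V : 'M[R[i]]_n.+1) (x y : 'I_n.+1 -> R) (X Y : 'M[int]_n.+1).

(** The eigenvalues are kept real although the eigenbasis is complex, so that
    their real powers make sense. *)
Definition conj_diag U x : 'M[R[i]]_n.+1 :=
  U^-1 * diag_mx (\row_i (real_complex R (x i))) * U.

Lemma conj_diagM U x y : U \is a GRing.unit ->
  conj_diag U x * conj_diag U y = conj_diag U (fun i => x i * y i).
Proof.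
move=> uU; apply: etrans (conjrM _ _ uU) _; congr (_ * _ * _).
rewrite -mulmxE mulmx_diag.
by congr diag_mx; apply/rowP=> i; rewrite !mxE rmorphM.
Qed.

Lemma conj_diag1 U : U \is a GRing.unit -> conj_diag U (fun=> 1) = 1.
Proof.
move=> uU; rewrite /conj_diag.
suff -> : \row_(i < n.+1) real_complex R 1 = const_mx 1.
  by rewrite diag_const_mx mulr1 mulVr.
by apply/rowP=> i; rewrite !mxE.
Qed.

Lemma eq_conj_diag U x y : x =1 y -> conj_diag U x = conj_diag U y.
Proof. by move=> /funext ->. Qed.

Lemma conj_diagXn U x k : U \is a GRing.unit ->
  conj_diag U x ^+ k = conj_diag U (fun i => x i ^+ k).
Proof.
move=> uU; elim: k => [|k IH].
  by rewrite expr0 -(conj_diag1 uU); apply: eq_conj_diag => i; rewrite expr0.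
rewrite exprS IH (conj_diagM _ _ uU); apply: eq_conj_diag => i.
by rewrite exprS.
Qed.

Lemma conj_diagV U x : U \is a GRing.unit -> (forall i, x i != 0) ->
  (conj_diag U x)^-1 = conj_diag U (fun i => (x i)^-1).
Proof.
move=> uU x0.
by apply: invr_unique; rewrite (conj_diagM _ _ uU) -(conj_diag1 uU);
  apply: eq_conj_diag => i; rewrite ?mulVf ?mulfV.
Qed.

Lemma conj_diagXz U x (k : int) : U \is a GRing.unit -> (forall i, x i != 0) ->
  conj_diag U x ^ k = conj_diag U (fun i => x i ^ k).
Proof.
move=> uU x0; case: k => k; first exact: conj_diagXn.
rewrite !NegzE -exprnN (conj_diagXn _ _ uU) (conj_diagV uU) //.
by move=> i; rewrite expf_neq0.
Qed.

(** Uniqueness of positive definite roots. With W = U / V the hypothesis reads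
    x_i^l W_ij = W_ij y_j^l, so x_i = y_j wherever W_ij is nonzero. *)
Lemma conj_diag_root_inj U V x y l : U \is a GRing.unit -> V \is a GRing.unit ->
  (forall i, 0 < x i) -> (forall i, 0 < y i) -> (0 < l)%N ->
  conj_diag U x ^+ l = conj_diag V y ^+ l -> conj_diag U x = conj_diag V y.
Proof.
move=> uU uV x0 y0 l0; rewrite (conj_diagXn x l uU) (conj_diagXn y l uV).
move=> E; apply/(conjr_eq _ _ uU uV); move/(conjr_eq _ _ uU uV): E.
move: (U / V) => W /matrixP E; apply/matrixP=> i j.
have := E i j; rewrite -mulmxE !mul_diag_mx !mul_mx_diag !mxE.
have [->|w0] := eqVneq (W i j) 0; first by rewrite !mulr0 !mul0r.
rewrite mulrC => /(mulfI w0) /complexI /eqP e.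
have /eqP -> : x i == y j by rewrite -(eqrXn2 l0) // ltW.
by rewrite mulrC.
Qed.

Definition diagonalised_by U x X := map_mx intr X = conj_diag U x.

Lemma diagonalised_inj U x X Y :
  diagonalised_by U x X -> diagonalised_by U x Y -> X = Y.
Proof. by rewrite /diagonalised_by => <- /map_intr_inj. Qed.

Lemma diagonalised_trace U x X : U \is a GRing.unit ->
  diagonalised_by U x X -> (\tr X)%:~R = \sum_i x i.
Proof.
move=> uU e; apply: (@complexI R).
rewrite (rmorph_int (real_complex R)) (rmorph_sum (real_complex R)).
have -> : (\tr X)%:~R = \tr (map_mx intr X : 'M[R[i]]_n.+1).
  by rewrite /mxtrace rmorph_sum; apply: eq_bigr => i _; rewrite mxE.
rewrite e /conj_diag -mulmxE mxtrace_mulC mulmxE mulrA mulrV // mul1r.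
by rewrite mxtrace_diag; apply: eq_bigr => i _; rewrite mxE.
Qed.

Lemma diagonalised_le_trace U x X i : U \is a GRing.unit ->
  (forall j, 0 < x j) -> diagonalised_by U x X -> x i <= (\tr X)%:~R.
Proof.
move=> uU x0 eX; rewrite (diagonalised_trace uU eX) (bigD1 i) //= lerDl.
by rewrite sumr_ge0 // => j _; exact: ltW.
Qed.

Lemma diagonalised_det U x X : U \is a GRing.unit ->
  diagonalised_by U x X -> (\det X)%:~R = \prod_i x i.
Proof.
move=> uU e; apply: (@complexI R).
rewrite (rmorph_int (real_complex R)) (rmorph_prod (real_complex R)).
rewrite -det_map_mx e /conj_diag -!mulmxE !det_mulmx mulrC mulrA -det_mulmx.
rewrite mulmxE mulrV // det1 mul1r det_diag.
by apply: eq_bigr => i _; rewrite mxE.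
Qed.

Lemma symmetric_diagonalised X : X^T = X -> \det X != 0 ->
  exists U d, [/\ U \is a GRing.unit, forall i, d i != 0 &
    diagonalised_by U d X].
Proof.
move=> Xs X0; pose A : 'M[R[i]]_n.+1 := map_mx intr X.
have Ah : A \is hermsymmx.
  apply/is_hermitianmxP; rewrite expr0 scale1r.
  apply/matrixP=> i j; rewrite !mxE conj_Creal ?realz //.
  by rewrite -[in LHS]Xs mxE.
have An := hermitian_normalmx Ah.
have e := orthomx_spectralP An.
have r := hermitian_spectral_diag_real Ah.
set U := spectralmx A in e; set D := spectral_diag A in e r.
pose d i := complex.Re (D 0 i).
have eD : D = \row_i (real_complex R (d i)).
  apply/rowP=> i; rewrite mxE /d RRe_real //.
  by move/mxOverP: r => /(_ 0 i).
have uU : U \is a GRing.unit by exact: spectral_unit.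
have E : diagonalised_by U d X by rewrite /diagonalised_by /conj_diag -eD.
exists U, d; split=> // i; apply: contraNneq X0 => di0.
have := diagonalised_det uU E.
by rewrite (bigD1 i) //= di0 mul0r => /eqP; rewrite intr_eq0.
Qed.

End ConjDiag.

(** * The exponent attached to a dependent pair *)

Section Exponent.
Variables (R : realType) (n : nat).
Implicit Types (A B X : 'M[int]_n.+1).

Lemma map_intr_unit (F : numFieldType) X : \det X != 0 ->
  (map_mx intr X : 'M[F]_n.+1) \is a GRing.unit.
Proof. by move=> X0; rewrite unitmxE det_map_mx unitfE intr_eq0. Qed.

Lemma map_ratr_intr (F : numFieldType) X :
  map_mx ratr (map_mx intr X : 'M[rat]_n.+1) = map_mx intr X :> 'M[F]_n.+1.
Proof. by apply/matrixP=> i j; rewrite !mxE ratr_int. Qed.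

Lemma rat_relation_transfer (F : numFieldType) A B l (k : int) : \det A != 0 ->
  (map_mx intr B : 'M[rat]_n.+1) ^+ l = (map_mx intr A : 'M[rat]_n.+1) ^ k ->
  (map_mx intr B : 'M[F]_n.+1) ^+ l = (map_mx intr A : 'M[F]_n.+1) ^ k.
Proof.
move=> A0 /(congr1 (map_mx (@ratr F))).
rewrite rmorphXn rmorphXz ?map_intr_unit //.
by rewrite /= !map_ratr_intr.
Qed.

Lemma exprz_eq1_root A (k : int) : \det A != 0 -> k != 0 ->
  (map_mx intr A : 'M[rat]_n.+1) ^ k = 1 -> root_of_identity A.
Proof.
move=> A0 k0 e; exists `|k|%N; first by rewrite absz_gt0.
apply: (@map_intr_inj rat n); rewrite rmorph1 rmorphXn.
have u := map_intr_unit rat A0.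
case: k {k0} e => k //= /(congr1 (fun M => M^-1)).
by rewrite NegzE -exprnN invrK invr1.
Qed.

(** The exponent of B cannot vanish, since A is not a root of the identity;
    inverting the relation if necessary makes it positive. *)
Lemma dependent_power A B : \det A != 0 -> \det B != 0 ->
  mul_dependent A B -> ~ root_of_identity A ->
  exists l k, (0 < l)%N /\
    (map_mx intr B : 'M[rat]_n.+1) ^+ l = (map_mx intr A : 'M[rat]_n.+1) ^ k.
Proof.
move=> A0 B0 [k [l [kl0 e]]] rA.
have uA := map_intr_unit rat A0; have uB := map_intr_unit rat B0.
have l0 : l != 0.
  apply/eqP => l0; move: kl0 e; rewrite l0 expr0z mulr1 => kl0 e.
  by apply: rA (exprz_eq1_root A0 _ e); apply: contraNneq kl0 => ->.
have {e} : (map_mx intr B : 'M[rat]_n.+1) ^ l =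
    (map_mx intr A : 'M[rat]_n.+1) ^ (- k).
  by rewrite -[LHS]mul1r -(mulVr (unitrXz k uA)) -mulrA e mulr1 invr_expz.
case: l l0 {kl0} => l l0 e; first by exists l, (- k); rewrite lt0n.
exists l.+1, k; split=> //.
by rewrite -[LHS]invrK exprnN -NegzE e invr_expz opprK.
Qed.

Lemma square_diagonalised A : A^T = A -> \det A != 0 ->
  exists U (p : 'I_n.+1 -> R), [/\ U \is a GRing.unit, forall i, 0 < p i &
    diagonalised_by U p (A * A)].
Proof.
move=> As A0; have [U [d [uU d0 e]]] := symmetric_diagonalised R As A0.
exists U, (fun i => d i * d i); split=> [|i|]; first exact: uU.
  by rewrite -expr2 exprn_even_gt0 // d0 orbT.
rewrite /diagonalised_by -(conj_diagM _ _ uU) -e.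
by rewrite -[in LHS]mulmxE map_mxM.
Qed.

(** When k is negative, b^l a^(-k) = 1 forces a = b = 1, and both
    valuations vanish. *)
Lemma logn_exponent (a b l : nat) (k : int) q : (0 < l)%N ->
  (0 < a)%N -> b%:R ^+ l = a%:R ^ k :> rat ->
  (logn q b)%:R = k%:~R / l%:R * (logn q a)%:R :> rat.
Proof.
move=> l0 a0.
have l0' : (l%:R : rat) != 0 by rewrite pnatr_eq0 -lt0n.
case: k => k e.
  have /(congr1 (logn q)) : (b ^ l = a ^ k)%N.
    by apply/eqP; rewrite -(eqr_nat rat) !natrX e.
  rewrite !lognX => /(congr1 (fun x => x%:R : rat)); rewrite !natrM => h.
  by apply: (mulfI l0'); rewrite h mulrA mulrCA mulfV // mulr1.
have : (b ^ l * a ^ k.+1 = 1)%N.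
  apply/eqP; rewrite -(eqr_nat rat) natrM !natrX e NegzE -exprnN mulVf //.
  by rewrite expf_neq0 // pnatr_eq0 -lt0n.
case: l l0 {l0' e} => // l _; rewrite !expnS => /eqP.
rewrite !muln_eq1 => /andP[/andP[/eqP -> _] /andP[/eqP -> _]].
by rewrite logn1 mulr0.
Qed.

(** From B^l = A^k the square of B is the positive definite l-th root of
    (A^2)^k, and r = k / l. When |det A| > 1, the valuations at a prime
    dividing det A recover r. *)
Lemma dependent_exponent A B U (p : 'I_n.+1 -> R) :
  A^T = A -> B^T = B -> \det A != 0 -> \det B != 0 ->
  mul_dependent A B -> ~ root_of_identity A ->
  U \is a GRing.unit -> (forall i, 0 < p i) -> diagonalised_by U p (A * A) ->
  exists r : rat, diagonalised_by U (fun i => p i `^ ratr r) (B * B) /\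
    forall q, (logn q `|\det B|)%:R = r * (logn q `|\det A|)%:R.
Proof.
move=> As Bs A0 B0 dAB rA uU p0 eA.
have [l [k [l0 e]]] := dependent_power A0 B0 dAB rA.
exists (k%:~R / l%:R); split; last first.
  move=> q; apply: logn_exponent; rewrite ?absz_gt0 //.
  have /(congr1 determinant) := e.
  have det_exprz (M : 'M[rat]_n.+1) (m : int) : \det (M ^ m) = \det M ^ m.
    case: m => m; first exact: det_expr.
    by rewrite NegzE -!exprnN detV det_expr.
  rewrite det_expr det_exprz !det_map_mx => /(congr1 Num.norm).
  rewrite normrX !natr_absz !intr_norm => ->.
  case: k {e} => k; first exact: normrX.
  by rewrite NegzE -!exprnN normfV normrX.
have [V [b [uV b0 eB]]] := square_diagonalised Bs B0.
rewrite /diagonalised_by eB; apply: (conj_diag_root_inj uV uU b0 _ l0) => [i|].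
  by rewrite powR_gt0.
have pn0 i : p i != 0 by rewrite gt_eqF.
rewrite -eB [RHS](conj_diagXn _ _ uU).
have -> : conj_diag U (fun i => (p i `^ ratr (k%:~R / l%:R)) ^+ l) =
  conj_diag U (fun i => p i ^ k).
  apply: eq_conj_diag => i; rewrite -powR_mulrn ?powR_ge0 // -powRrM.
  rewrite rmorphM fmorphV /= ratr_int ratr_nat mulfVK ?powR_intmul ?ltW //.
  by rewrite pnatr_eq0 -lt0n.
rewrite -(conj_diagXz _ uU pn0) -eA.
have := rat_relation_transfer R[i] A0 e.
have sq X : map_mx intr (X * X) = (map_mx intr X : 'M[R[i]]_n.+1) ^+ 2.
  by rewrite -expr2 rmorphXn.
move=> E; rewrite !sq exprAC E.
by rewrite !exprnP !exprz_exp mulrC.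
Qed.
End Exponent.

(** * The squares attached to a given matrix are few *)

Section CountSquares.
Variables (R : realType) (n : nat).
Implicit Types (A B X Y Q : 'M[int]_n.+1) (U : 'M[R[i]]_n.+1).
Implicit Types (p x y : 'I_n.+1 -> R).

(** X / Y is a positive definite integer matrix of determinant 1. Its trace is
    at least n.+1 by the inequality of the means, with equality only for the
    identity, so it is at least n.+2, and the largest of its n.+1 eigenvalues
    is at least the average. *)
Lemma unimodular_gap U x y X Y a : U \is a GRing.unit ->
  (forall i, 0 < x i) -> (forall i, 0 < y i) ->
  diagonalised_by U x X -> diagonalised_by U y Y ->
  \prod_i x i = 1 -> \prod_i y i = 1 ->
  (forall i, x i / y i <= x a / y a) -> X != Y ->
  n.+2%:R * y a <= n.+1%:R * x a.
Proof.
move=> uU x0 y0 eX eY x1 y1 amax XY.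
have dY : \det Y = 1.
  have := diagonalised_det uU eY; rewrite y1 => /eqP.
  by rewrite (eqr_int R _ 1) => /eqP.
have uY : Y \is a GRing.unit by rewrite unitmxE dY unitr1.
pose z i := x i / y i.
have z0 i : 0 < z i by rewrite divr_gt0.
have eZ : diagonalised_by U z (X * Y^-1).
  have y_neq0 i : y i != 0 by rewrite gt_eqF.
  have eV : map_mx intr Y^-1 = conj_diag U (fun i => (y i)^-1).
    by rewrite (rmorphV _ uY) /= eY; exact: conj_diagV.
  rewrite /diagonalised_by rmorphM /= eX eV; exact: conj_diagM.
have trZ := diagonalised_trace uU eZ.
have [le eq] := leif_AGM (A := predT) (fun i _ => ltW (z0 i)).
have z1 : \prod_i z i = 1 by rewrite big_split /= prodfV x1 y1 invr1 mulr1.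
have sgt : n.+1%:R < \sum_i z i.
  rewrite ltNge; apply/negP => sle; case/negP: XY; apply/eqP.
  have mu1 : ((\sum_i z i) / n.+1%:R) ^+ n.+1 <= 1.
    rewrite exprn_ile1 ?divr_ge0 ?sumr_ge0 // => [i _|]; first exact: ltW.
    by rewrite ler_pdivrMr ?mul1r ?ltr0n.
  have mueq : [forall i in predT, forall j in predT, z i == z j].
    rewrite -eq cardT size_enum_ord; apply/eqP/le_anti.
    move: le; rewrite cardT size_enum_ord => -> /=.
    by rewrite (le_trans mu1) // z1.
  have zc i : z i = z a.
    by move/forall_inP: mueq => /(_ i isT) /forall_inP /(_ a isT) /eqP.
  have za1 : z a = 1.
    move: z1; rewrite (eq_bigr (fun=> z a)) // prodr_const card_ord => /eqP.
    by rewrite pexpr_eq1 ?ltW // => /eqP.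
  apply: (diagonalised_inj eX); rewrite /diagonalised_by eY.
  apply: eq_conj_diag => i; have := zc i.
  by rewrite za1 /z => /(canRL (divfK (lt0r_neq0 (y0 i)))); rewrite mul1r.
have sge : n.+2%:R <= \sum_i z i.
  move: sgt; rewrite -trZ -[n.+1%:R]/(n.+1%:Z%:~R) -[n.+2%:R]/(n.+2%:Z%:~R).
  by rewrite ltr_int ler_int.
rewrite -ler_pdivlMr // -mulrA (le_trans sge) //.
rewrite mulr_natl -[n.+1 in leRHS]card_ord -sumr_const.
by apply: ler_sum => i _; exact: amax.
Qed.

Lemma geometric_path (a b : R) (T : Type) (f : T -> R) t s : 0 <= a -> 0 <= b ->
  path (fun t u => a * f t <= b * f u) t s ->
  a ^+ size s * f t <= b ^+ size s * f (last t s).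
Proof.
move=> a0 b0; elim: s t => [|u s IH] t; first by rewrite !mul1r.
move=> /= /andP[tu /IH us].
rewrite exprSr -mulrA (le_trans (ler_wpM2l (exprn_ge0 _ a0) tu)) //.
by rewrite mulrCA exprS -mulrA ler_wpM2l.
Qed.

Lemma prod_powR p (r : R) : (forall i, 0 < p i) ->
  \prod_i (p i `^ r) = (\prod_i p i) `^ r.
Proof.
move=> p0; apply: (proj1 (A := _ = _) (B := 0 <= \prod_i p i)).
elim/big_rec2: _ => [|i u v _ [-> v0]]; first by rewrite powR1.
by rewrite powRM ?mulr_ge0 // ltW.
Qed.

Lemma uniq_nat_has_large (s : seq nat) : uniq s -> s != [::] ->
  exists2 k, k \in s & ((size s).-1 <= k)%N.
Proof.
move=> us s0; apply/hasP; rewrite -[has _ _]negbK -all_predC.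
apply/negP => /allP h.
have /(uniq_leq_size us) : {subset s <= iota 0 (size s).-1}.
  by move=> k /h /=; rewrite mem_iota -ltnNge.
by rewrite size_iota; case: s s0 {us h} => //= _ s _; rewrite ltnn.
Qed.

(** Sorted by exponent, the values p_a^r at the largest eigenvalue p_a grow
    at each step by a factor (n+2)/(n+1). They are at most T, and at least
    T^-n because the n.+1 eigenvalues of each square have product 1. *)
Lemma count_unimodular_powers U p (T : nat) (s : seq 'M[int]_n.+1)
    (r : 'M[int]_n.+1 -> rat) :
  U \is a GRing.unit -> (forall i, 0 < p i) -> \prod_i p i = 1 -> uniq s ->
  s != [::] ->
  (forall Q, Q \in s -> diagonalised_by U (fun i => p i `^ ratr (r Q)) Q) ->
  (forall Q, Q \in s -> \tr Q <= T%:Z) ->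
  (n.+2 ^ (size s).-1 <= n.+1 ^ (size s).-1 * T ^ n.+1)%N.
Proof.
move=> uU p0 p1 us s0 hr hT.
pose a := [arg max_(i > ord0) p i]%O.
have amax i : p i <= p a by rewrite /a; case: arg_maxP => //= a' _; apply.
pose q (Q : 'M[int]_n.+1) i : R := p i `^ ratr (r Q).
have q0 Q i : 0 < q Q i by rewrite powR_gt0.
have q1 Q : \prod_i q Q i = 1 by rewrite /q prod_powR // p1 powR1.
have qT Q i : Q \in s -> q Q i <= T%:R.
  move=> Qs.
  apply: le_trans (diagonalised_le_trace i uU (q0 Q) (hr Q Qs)) _.
  by rewrite -[T%:R]/(T%:Z%:~R) ler_int hT.
pose leQ (Q Q' : 'M[int]_n.+1) := r Q <= r Q'.
pose t := sort leQ s.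
have st : sorted leQ t by apply: sort_sorted => x y; exact: le_total.
have ut : uniq t by rewrite sort_uniq.
have mt : t =i s by move=> Q; rewrite mem_sort.
have zt : size t = size s by rewrite size_sort.
rewrite -zt; case: t zt st ut mt => [|Q0 t] zt st ut mt.
  by case: s s0 zt {us hr hT qT mt}.
have pt : path (fun Q Q' => n.+2%:R * q Q a <= n.+1%:R * q Q' a) Q0 t.
  have tr : transitive leQ by move=> x y z; exact: le_trans.
  have pw : pairwise [rel Q Q' | leQ Q Q' && (Q != Q')] (Q0 :: t).
    by rewrite pairwise_relI -uniq_pairwise ut andbT -sorted_pairwise.
  have := pairwise_sorted pw.
  apply: (@sub_in_sorted _ [in s]); last by apply/allP => Q; rewrite mt.
  move=> Q Q' Qs Q's /= /andP[rQQ' nQ].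
  apply: (unimodular_gap uU (q0 Q') (q0 Q) (hr Q' Q's) (hr Q Qs)
    (q1 Q') (q1 Q)).
    have pd k : q Q' k / q Q k = p k `^ ratr (r Q' - r Q).
      by rewrite rmorphB /= powRB // (gt_eqF (p0 k)) implybT.
    move=> i; rewrite !pd ge0_ler_powR ?nnegrE ?(ltW (p0 _)) //.
    by rewrite ler0q subr_ge0.
  by rewrite eq_sym.
have := geometric_path (ler0n R _) (ler0n R _) pt => /=.
set m := size t; set Q1 := last Q0 t.
have Q1s : Q1 \in s by rewrite -mt mem_last.
have Q0s : Q0 \in s by rewrite -mt mem_head.
have low : 1 <= q Q0 a * T%:R ^+ n.
  have -> : T%:R ^+ n = \prod_(i | i != a) T%:R :> R.
    by rewrite prodr_const cardC1 card_ord.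
  rewrite -[leLHS](q1 Q0) (bigD1 a) //= (ler_wpM2l (ltW (q0 _ _))) //.
  by apply: ler_prod => i _; rewrite qT // (ltW (q0 _ _)).
move=> ch; rewrite -(ler_nat R) natrM !natrX.
apply: (le_trans (y := n.+2%:R ^+ m * q Q0 a * T%:R ^+ n)).
  by rewrite -mulrA ler_peMr ?exprn_ge0.
rewrite exprS mulrA ler_wpM2r ?exprn_ge0 // (le_trans ch) //.
by rewrite ler_wpM2l ?exprn_ge0 ?qT.
Qed.

(** The q-adic valuations of the integers b determine the exponents, so they
    are pairwise distinct and one of them is at least the number of squares
    minus one. As q >= 2, this already gives growth by a factor
    2 >= (n+2)/(n+1), so the bound has the same form as in the unimodular
    case. *)
Lemma count_nonunit_powers U p (T q v : nat) (s : seq 'M[int]_n.+1)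
    (r : 'M[int]_n.+1 -> rat) (b : 'M[int]_n.+1 -> nat) :
  U \is a GRing.unit -> (forall i, 0 < p i) -> prime q -> (0 < v)%N ->
  uniq s -> s != [::] ->
  (forall Q, Q \in s -> diagonalised_by U (fun i => p i `^ ratr (r Q)) Q) ->
  (forall Q, Q \in s -> \tr Q <= T%:Z) ->
  (forall Q, Q \in s -> (0 < b Q)%N /\ \det Q = (b Q)%:Z ^+ 2) ->
  (forall Q, Q \in s -> (logn q (b Q))%:R = r Q * v%:R) ->
  (n.+2 ^ (size s).-1 <= n.+1 ^ (size s).-1 * T ^ n.+1)%N.
Proof.
move=> uU p0 pq v0 us s0 hr hT hb hv.
have v0' : (v%:R : rat) != 0 by rewrite pnatr_eq0 -lt0n.
have uk : uniq [seq logn q (b Q) | Q <- s].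
  rewrite map_inj_in_uniq // => Q Q' Qs Q's e.
  have rr : r Q = r Q' by apply: (mulIf v0'); rewrite -!hv // e.
  by apply: (diagonalised_inj (hr Q Qs)); rewrite rr; exact: hr.
have [|k] := uniq_nat_has_large uk; first by case: (s) s0.
move=> /mapP[Q Qs ->]; rewrite size_map; set m := (size s).-1 => mk.
have [b0 dQ] := hb Q Qs.
have q0 i : 0 < p i `^ ratr (r Q) by rewrite powR_gt0.
have bT : (b Q <= T ^ n.+1)%N.
  apply: (@leq_trans (b Q ^ 2)); first by rewrite -mulnn leq_pmull.
  rewrite -(ler_nat R) !natrX.
  have -> : (b Q)%:R ^+ 2 = (\det Q)%:~R :> R by rewrite dQ rmorphXn.
  have -> : T%:R ^+ n.+1 = \prod_(i < n.+1) T%:R :> R.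
    by rewrite prodr_const card_ord.
  rewrite (diagonalised_det uU (hr Q Qs)).
  apply: ler_prod => i _; rewrite (ltW (q0 i)) //=.
  apply: le_trans (diagonalised_le_trace i uU q0 (hr Q Qs)) _.
  by rewrite -[T%:R]/(T%:Z%:~R) ler_int hT.
have ex2r c d e : (c <= d)%N -> (c ^ e <= d ^ e)%N.
  by case: e => // e; rewrite leq_exp2r.
apply: (@leq_trans ((n.+1 * 2) ^ m)).
  by apply: ex2r; rewrite muln2 -addnn addSn addnS !ltnS leq_addl.
rewrite expnMn leq_mul2l (leq_trans _ bT) ?orbT //.
apply: leq_trans (dvdn_leq b0 (pfactor_dvdnn q _)).
apply: (@leq_trans (q ^ m)); first exact/ex2r/prime_gt1.
by rewrite leq_pexp2l // prime_gt0.
Qed.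

(** A logarithmic bound in T for the number of squares: the geometric growth
    ((n+2)/(n+1))^(size - 1) is bounded by T^(n+1). *)
Lemma count_squares A (T : nat) (s : seq 'M[int]_n.+1) :
  A^T = A -> \det A != 0 -> ~ root_of_identity A -> (0 < T)%N -> uniq s ->
  (forall Q, Q \in s -> exists B, [/\ B^T = B, \det B != 0, mul_dependent A B,
     Q = B * B & \tr Q <= T%:Z]) ->
  (n.+2 ^ (size s).-1 <= n.+1 ^ (size s).-1 * T ^ n.+1)%N.
Proof.
move=> As A0 rA T0 us hs.
have [->|s0] := eqVneq s [::]; first by rewrite !expn0 mul1n expn_gt0 T0.
have [U [p [uU p0 eA]]] := square_diagonalised R As A0.
have /choice[rb hrb] : forall Q, exists rb : rat * nat, Q \in s ->
    [/\ diagonalised_by U (fun i => p i `^ ratr rb.1) Q, \tr Q <= T%:Z,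
      (0 < rb.2)%N /\ \det Q = rb.2%:Z ^+ 2 &
      forall q, (logn q rb.2)%:R = rb.1 * (logn q `|\det A|)%:R].
  move=> Q; have [Qs|_] := boolP (Q \in s); last by exists (0, 0%N).
  have [B [Bs B0 dAB eQ tQ]] := hs Q Qs.
  have [r [rU rv]] := dependent_exponent As Bs A0 B0 dAB rA uU p0 eA.
  exists (r, `|\det B|%N) => _.
  split; [by rewrite eQ | exact: tQ | | exact: rv].
  split; first by rewrite absz_gt0.
  by rewrite eQ -mulmxE det_mulmx -expr2 abszE real_normK ?num_real.
have [dA|dA] := eqVneq `|\det A|%N 1%N.
  apply: (count_unimodular_powers (r := fun Q => (rb Q).1) uU p0 _ us s0);
    try by move=> Q /hrb[].
  rewrite -(diagonalised_det uU eA) -mulmxE det_mulmx -expr2.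
  by rewrite -[_ ^+ 2]real_normK ?num_real // -abszE dA.
have dA1 : (1 < `|\det A|)%N by rewrite ltn_neqAle eq_sym dA absz_gt0.
apply: (count_nonunit_powers (r := fun Q => (rb Q).1) (b := fun Q => (rb Q).2)
  uU p0 (pdiv_prime dA1) _ us s0 _ _ _
  (v := logn (pdiv `|\det A|) `|\det A|)); try by move=> Q /hrb[].
by rewrite logn_gt0 mem_primes pdiv_prime // pdiv_dvd absz_gt0 A0.
Qed.

End CountSquares.

(** * A pair is determined by its code *)

Section CountPairs.
Variable n : nat.
Implicit Types (A B : 'M[int]_n.+1) (s : seq ('M[int]_n.+1 * 'M[int]_n.+1)).

Definition encode_entry (h : nat) (x : int) : 'I_(2 * h).+1 :=
  inord `|x + h%:Z|.

Definition decode_entry (h : nat) (k : 'I_(2 * h).+1) : int := k%:Z - h%:Z.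

Lemma encode_entryK h x : (`|x| <= h)%N -> decode_entry (encode_entry h x) = x.
Proof. by move=> xh; rewrite /decode_entry inordK; lia. Qed.

Lemma encode_entry_inj h x y : (`|x| <= h)%N -> (`|y| <= h)%N ->
  encode_entry h x = encode_entry h y -> x = y.
Proof. by move=> xh yh e; rewrite -(encode_entryK xh) e encode_entryK. Qed.

Lemma square_diag_entry B i : B^T = B ->
  (B * B) i i = B i i ^+ 2 + \sum_(j | j != i) B i j ^+ 2.
Proof.
move=> Bs; rewrite -mulmxE mxE (bigD1 i) //= -expr2; congr (_ + _).
by apply: eq_bigr => j _; rewrite -[in B j i]Bs mxE expr2.
Qed.

(** Once the off-diagonal entries agree, the diagonal entries of the squares
    differ by the squares of the diagonal entries only. *)
Lemma sym_eq_of_square B B' : B^T = B -> B'^T = B' ->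
  (forall i j : 'I_n.+1, (j < i)%N -> B i j = B' i j) ->
  (forall i, (0 <= B i i) = (0 <= B' i i)) -> B * B = B' * B' -> B = B'.
Proof.
move=> Bs B's low sg sq.
have off i j : i != j -> B i j = B' i j.
  rewrite -(inj_eq val_inj) neq_ltn => /orP[ij|ij]; last exact: low.
  by rewrite -Bs -B's !mxE low.
apply/matrixP=> i j; have [<-|/off//] := eqVneq i j.
have := congr1 (fun M : 'M_n.+1 => M i i) sq.
rewrite !square_diag_entry //.
rewrite (eq_bigr (fun j => B' i j ^+ 2)) => [|k ki]; last first.
  by rewrite off // eq_sym.
move=> /addIr /eqP; rewrite eqf_sqr => /orP[/eqP //|/eqP e].
have := sg i; rewrite e; lia.
Qed.

(** The upper triangle of A and the strict lower triangle of B fill a single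
    square matrix, which is where the exponent n.+1 * n.+1 comes from. *)
Lemma size_dep_pairs_le h K s : uniq s ->
  (forall AB, AB \in s -> [/\ AB.1^T = AB.1, AB.2^T = AB.2,
     forall i j, (`|AB.1 i j| <= h)%N & forall i j, (`|AB.2 i j| <= h)%N]) ->
  (forall A (t : seq 'M[int]_n.+1), uniq t ->
     (forall Q, Q \in t -> exists2 B, (A, B) \in s & Q = B * B) ->
     (size t <= K.+1)%N) ->
  (size s <= (2 * h).+1 ^ (n.+1 * n.+1) * 2 ^ n.+1 * K.+1)%N.
Proof.
move=> us hs hK.
pose squares A := undup [seq AB.2 * AB.2 | AB <- s & AB.1 == A].
have size_squares A : (size (squares A) <= K.+1)%N.
  apply: (hK A); first exact: undup_uniq.
  move=> Q; rewrite mem_undup => /mapP[[A' B]].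
  by rewrite mem_filter => /andP[/eqP /= <- ABs ->]; exists B.
have mem_squares A B : (A, B) \in s -> B * B \in squares A.
  move=> ABs; rewrite mem_undup; apply/mapP; exists (A, B) => //.
  by rewrite mem_filter eqxx.
pose code (AB : 'M[int]_n.+1 * 'M[int]_n.+1) :=
  (\matrix_(i, j) encode_entry h (if (i <= j)%N then AB.1 i j else AB.2 i j),
   [ffun i => 0 <= AB.2 i i],
   inord (index (AB.2 * AB.2) (squares AB.1)) : 'I_K.+1).
have code_inj : {in s &, injective code}.
  move=> [A B] [A' B'] ABs ABs'; have /= [As Bs Ah Bh] := hs _ ABs.
  have /= [As' Bs' Ah' Bh'] := hs _ ABs'.
  case=> /matrixP eM /ffunP eS eI.
  have eA : A = A'.
    have up (i j : 'I_n.+1) : (i <= j)%N -> A i j = A' i j.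
      move=> ij; have := eM i j; rewrite !mxE ij => /encode_entry_inj; exact.
    apply/matrixP=> i j; have [/up //|/ltnW ji] := leqP i j.
    by rewrite -As -As' !mxE up.
  subst A'; congr pair; apply: sym_eq_of_square => //.
  - move=> i j ji; have := eM i j.
    by rewrite !mxE leqNgt ji /= => /encode_entry_inj; exact.
  - by move=> i; have := eS i; rewrite !ffunE.
  have lt (B0 : 'M[int]_n.+1) : (A, B0) \in s ->
      (index (B0 * B0)%R (squares A) < K.+1)%N.
    move=> ?; apply: leq_trans (size_squares A).
    by rewrite index_mem mem_squares.
  have /(congr1 val) := eI; rewrite /= !inordK ?(lt _ ABs) ?(lt _ ABs') // => e.
  rewrite -(nth_index 0 (mem_squares _ _ ABs)) e nth_index //.
  exact: mem_squares.
have uc : uniq (map code s) by rewrite map_inj_in_uniq.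
rewrite -(size_map code) -(card_uniqP uc).
apply: leq_trans (max_card _) _.
by rewrite !card_prod card_mx card_ffun card_bool !card_ord.
Qed.

Lemma trace_square_le h B : B^T = B -> (forall i j, (`|B i j| <= h)%N) ->
  \tr (B * B) <= (n.+1 * n.+1 * h ^ 2)%N%:Z.
Proof.
move=> Bs Bh; rewrite /mxtrace.
have -> : (n.+1 * n.+1 * h ^ 2)%N%:Z =
    \sum_(i < n.+1) \sum_(j < n.+1) (h ^ 2)%N%:Z.
  rewrite !sumr_const card_ord -!mulrnA -mulr_natr natz; lia.
apply: ler_sum => i _; rewrite -mulmxE mxE; apply: ler_sum => j _.
rewrite -[in B j i]Bs mxE -expr2 -[_ ^+ 2]real_normK ?num_real // -abszE.
by rewrite -mulnn PoszM -expr2 ler_sqr ?nnegrE // lez_nat.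
Qed.

Lemma finite_box h : finite_set
  [set A : 'M[int]_n.+1 | forall i j, (`|A i j| <= h)%N]%classic.
Proof.
apply: (@sub_finite_set _ _ (map_mx (@decode_entry h) @` setT)%classic).
  move=> A Ah; exists (map_mx (encode_entry h) A) => //.
  by apply/matrixP=> i j; rewrite !mxE encode_entryK.
exact: finite_image.
Qed.

Lemma mxheight_le h A : (0 < h)%N ->
  (mxheight A <= h)%N <-> (forall i j, (`|A i j| <= h)%N).
Proof.
move=> h0; rewrite /mxheight geq_max h0 /=; split=> [/bigmax_leqP hA i j|hA].
  by have /bigmax_leqP := hA i isT; apply.
by apply/bigmax_leqP => i _; apply/bigmax_leqP => j _.
Qed.

End CountPairs.

(** * Many matrices with determinant 2 modulo 5 *)

Section LowerBound.
Variables (n T : nat).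

Definition offset_mx : 'M[int]_n.+1 :=
  diag_mx (\row_i (if i == ord0 then 2 else 1)).

Definition lattice_mx (f : {ffun 'I_n.+1 * 'I_n.+1 -> 'I_T.+1}) :
    'M[int]_n.+1 :=
  offset_mx +
  \matrix_(i, j) (5 * (if (i <= j)%N then f (i, j) else f (j, i)))%N%:Z.

Lemma lattice_mx_sym f : (lattice_mx f)^T = lattice_mx f.
Proof.
apply/matrixP=> i j; rewrite !mxE; have [->|ij] := eqVneq i j; first by [].
rewrite !mulr0n !add0r; congr (Posz (5 * _)).
by move: ij; rewrite -(inj_eq val_inj); case: ltngtP.
Qed.

Lemma lattice_mx_det f : (\det (lattice_mx f))%:~R = 2 :> 'F_5.
Proof.
rewrite -det_map_mx.
have -> : map_mx intr (lattice_mx f) =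
    diag_mx (\row_i (if i == ord0 then 2 else 1)) :> 'M['F_5]_n.+1.
  apply/matrixP=> i j; rewrite !mxE rmorphD /=.
  rewrite [X in _ + X](_ : _ = 0) ?addr0.
    by have [->|ij] := eqVneq i j; rewrite ?mulr0n // !mulr1n; case: ifP.
  by rewrite -pmulrn natrM (_ : 5%:R = 0) ?mul0r //; apply/val_inj.
rewrite det_diag (bigD1 ord0) //= mxE eqxx big1 ?mulr1 // => i i0.
by rewrite mxE (negPf i0).
Qed.

Lemma lattice_mx_det_neq0 f : \det (lattice_mx f) != 0.
Proof. by apply/eqP => d0; have := lattice_mx_det f; rewrite d0 => /eqP. Qed.

(** The determinant of a root of the identity is 1 or -1, and neither is 2
    modulo 5. *)
Lemma lattice_mx_not_root f : ~ root_of_identity (lattice_mx f).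
Proof.
case=> k k0 /(congr1 determinant); rewrite det1.
rewrite det_expr => /(congr1 absz); rewrite abszX => /eqP.
case: k k0 => // k _; rewrite expnS muln_eq1 => /andP[/eqP d1 _].
have := lattice_mx_det f.
by rewrite [\det _]intEsign d1; case: (_ < _) => /eqP.
Qed.

Lemma lattice_mx_le f i j : (0 < T)%N -> (`|lattice_mx f i j| <= 7 * T)%N.
Proof.
move=> T0; rewrite !mxE; case: (f (i, j)) (f (j, i)) => [x xT] [y yT] /=.
by case: (i == j); case: (i == ord0); case: ifP => _;
  rewrite ?mulr1n ?mulr0n /=; lia.
Qed.

Lemma card_upper_triangle :
  #|[pred ij : 'I_n.+1 * 'I_n.+1 | (ij.1 <= ij.2)%N]| =
    ((n.+1 ^ 2 + n.+1) %/ 2)%N.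
Proof.
rewrite -sum1_card.
transitivity (\sum_(j < n.+1) \sum_(i < n.+1 | (i <= j)%N) 1)%N.
  rewrite (exchange_big_dep xpredT) //= pair_big_dep.
  by apply: eq_bigl => ij; rewrite !inE.
rewrite (eq_bigr (fun j : 'I_n.+1 => j.+1)) => [|j _]; last first.
  rewrite -(big_mkord (fun i => i <= j)%N (fun=> 1%N)).
  rewrite -(big_nat_widen 0 j.+1 n.+1 xpredT) //.
  by rewrite sum_nat_const_nat subn0 muln1.
elim: n.+1 => [|m IH]; first by rewrite big_ord0.
rewrite big_ord_recr /= IH.
have -> : (m.+1 ^ 2 + m.+1 = m.+1 * 2 + (m ^ 2 + m))%N by rewrite -!mulnn; lia.
by rewrite divnMDl // addnC.
Qed.

(** The functions are supported on the upper triangle because [lattice_mx]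
    only reads their values there: this makes it injective. *)
Definition lattice_family := [seq lattice_mx f | f <- enum
  (pffun_on (@ord0 T) [pred ij : 'I_n.+1 * 'I_n.+1 | (ij.1 <= ij.2)%N] predT)].

Lemma lattice_family_uniq : uniq lattice_family.
Proof.
rewrite map_inj_in_uniq ?enum_uniq // => f g; rewrite !mem_enum.
move=> /pffun_onP[/supportP sf _] /pffun_onP[/supportP sg _] /addrI /matrixP e.
apply/ffunP=> -[i j]; have [ij|ij] := boolP (i <= j)%N; last first.
  by rewrite sf // sg.
apply/val_inj => /=; have := e i j; rewrite !mxE ij; lia.
Qed.

Lemma size_lattice_family :
  size lattice_family = (T.+1 ^ ((n.+1 ^ 2 + n.+1) %/ 2))%N.
Proof.
by rewrite size_map -cardE card_pffun_on card_upper_triangle card_ord.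
Qed.

End LowerBound.

(** * The two estimates *)

Section Estimates.
Variables (R : realType) (n : nat) (c : R).
Implicit Types (H : R) (A B : 'M[int]_n.+1).

Lemma sym_mxs_le H A : 1 <= c * H -> sym_mxs c H A ->
  forall i j, (`|A i j| <= Num.truncn (c * H))%N.
Proof.
move=> cH1 [_ _ Ah]; apply/mxheight_le; first by rewrite truncn_gt0.
by rewrite truncn_ge_nat ?(le_trans ler01).
Qed.

Lemma finite_sym_dep_pairs H : 1 <= c * H ->
  finite_set (@sym_dep_pairs R n c H).
Proof.
move=> cH1; apply: sub_finite_set; last exact: (finite_setX
  (finite_box n (Num.truncn (c * H))) (finite_box n (Num.truncn (c * H)))).
by move=> AB [/(sym_mxs_le cH1) hA /(sym_mxs_le cH1) hB _ _ _].
Qed.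

Lemma mem_sym_dep_pairs H AB : 1 <= c * H ->
  (AB \in fset_set (@sym_dep_pairs R n c H)) = (AB \in @sym_dep_pairs R n c H).
Proof. by move=> cH1; rewrite in_fset_set //; exact: finite_sym_dep_pairs. Qed.

Lemma num_sym_dep_pairs_ge H (T : nat) : (0 < T)%N -> (7 * T)%:R <= c * H ->
  (T.+1 ^ ((n.+1 ^ 2 + n.+1) %/ 2) <= num_sym_dep_pairs n c H)%N.
Proof.
move=> T0 TH; have cH1 : 1 <= c * H.
  by rewrite (le_trans _ TH) // ler1n muln_gt0.
rewrite -(size_lattice_family n T) -(size_map (fun A => (A, A))).
apply: uniq_leq_size => [|AB /mapP[A /mapP[f _ ->] ->]].
  by rewrite map_inj_uniq ?lattice_family_uniq // => A B [].
rewrite mem_sym_dep_pairs //; apply/mem_set.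
have S : sym_mxs c H (lattice_mx f).
  split; [exact: lattice_mx_sym | exact: lattice_mx_det_neq0 |].
  apply: le_trans TH; rewrite ler_nat.
  apply/mxheight_le; first by rewrite muln_gt0.
  by move=> i j; exact: lattice_mx_le.
split=> //=; [|exact: lattice_mx_not_root..].
exists 1, (-1); split=> //.
by rewrite expr1z exprN1 mulrV // map_intr_unit ?lattice_mx_det_neq0.
Qed.

Definition gap_log : R := ln (n.+2%:R / n.+1%:R).

Lemma gap_log_gt0 : 0 < gap_log.
Proof. by rewrite ln_gt0 // ltr_pdivlMr // mul1r ltr_nat. Qed.

Lemma exponent_le_log (m t : nat) : (0 < t)%N ->
  (n.+2 ^ m <= n.+1 ^ m * t)%N -> m%:R * gap_log <= ln t%:R.
Proof.
move=> t0; rewrite -(ler_nat R) natrM !natrX => h.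
rewrite mulr_natl -lnXn ?divr_gt0 //.
rewrite ler_ln ?posrE ?exprn_gt0 ?divr_gt0 ?ltr0n //.
by rewrite expr_div_n ler_pdivrMr ?exprn_gt0 // mulrC.
Qed.

(** The bound that [count_squares] gives for trace at most N^2 h^2, where
    N = n.+1: B has N^2 entries of absolute value at most h, and the trace of
    B^2 is the sum of their squares. *)
Definition squares_bound (h : nat) : nat :=
  Num.truncn (ln ((n.+1 * n.+1 * h ^ 2) ^ n.+1)%:R / gap_log).

Lemma num_sym_dep_pairs_le H (h := Num.truncn (c * H)) : 1 <= c * H ->
  (num_sym_dep_pairs n c H <=
    (2 * h).+1 ^ (n.+1 * n.+1) * 2 ^ n.+1 * (squares_bound h).+1)%N.
Proof.
move=> cH1.
have h0 : (0 < h)%N by rewrite truncn_gt0.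
have T0 : (0 < (n.+1 * n.+1 * h ^ 2))%N by rewrite !(muln_gt0, expn_gt0) h0.
have mem AB : AB \in fset_set (@sym_dep_pairs R n c H) ->
    @sym_dep_pairs R n c H AB.
  by rewrite mem_sym_dep_pairs // => /set_mem.
apply: size_dep_pairs_le; first exact: fset_uniq.
  move=> AB /mem [SA SB _ _ _]; split; try exact: sym_mxs_le.
    by case: SA.
  by case: SB.
move=> A t ut ht; case: t => [//|Q0 t] in ut ht *.
have [B0 /mem [[/= As A0 _] _ _ rA _] _] := ht Q0 (mem_head _ _).
have tpos : (0 < (n.+1 * n.+1 * h ^ 2) ^ n.+1)%N by rewrite expn_gt0 T0.
have /(exponent_le_log tpos) key : (n.+2 ^ (size (Q0 :: t)).-1 <=
    n.+1 ^ (size (Q0 :: t)).-1 * (n.+1 * n.+1 * h ^ 2) ^ n.+1)%N.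
  apply: (count_squares R As A0 rA T0 ut) => Q /ht[B /mem[_ /= SB d _ _] ->].
  have [Bs Bd _] := SB; exists B.
  by split=> //; apply: trace_square_le => //; exact: sym_mxs_le SB.
rewrite ltnS truncn_ge_nat; first by rewrite ler_pdivlMr ?gap_log_gt0.
by rewrite divr_ge0 ?(ltW gap_log_gt0) // ln_ge0 // ler1n.
Qed.

End Estimates.

Theorem theorem19 (R : realType) (n : nat) (c : R) (hc : 0 < c) :
  exists C' C'' H0 : R, [/\ 0 < C', 0 < C'', 2 <= H0 &
    forall H : R, H0 <= H ->
      C' * H ^+ ((n.+1 ^ 2 + n.+1) %/ 2)%N <= (num_sym_dep_pairs n c H)%:R /\
      (num_sym_dep_pairs n c H)%:R
        <= C'' * H ^+ (n.+1 ^ 2)%N * ln H ^+ (2 + n.+1)%N].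
Proof.
pose g := gap_log R n; have g0 : 0 < g := gap_log_gt0 R n.
(* The four terms of the threshold for H give 2 <= H, 1 <= ln H, 7 <= c * H
   and N^2 h^2 <= H^4 for h <= c * H, N = n.+1. For the lower constant,
   [lattice_mx] has entries at most 7 * T. For the upper one,
   2 h + 1 <= 3 c H, and ln (N^2 h^2)^N <= 4 N ln H bounds the squares. *)
exists ((c / 7) ^+ ((n.+1 ^ 2 + n.+1) %/ 2)),
  ((3 * c) ^+ (n.+1 ^ 2) * 2 ^+ n.+1 * (1 + 4 * n.+1%:R / g)),
  (2 + expR 1 + 7 / c + n.+1%:R * c).
have c0 : 0 <= c by exact: ltW.
have e0 : 0 <= expR 1 :> R by exact: expR_ge0.
have c7 : 0 <= 7 / c by rewrite divr_ge0.
have nc0 : 0 <= n.+1%:R * c by rewrite mulr_ge0.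
split.
- by rewrite exprn_gt0 // divr_gt0.
- rewrite !mulr_gt0 ?exprn_gt0 ?mulr_gt0 // addr_gt0 ?divr_gt0 ?mulr_gt0 //.
- by lra.
move=> H HH.
have H_ge7 : 7 / c <= H by lra.
have H_gee : expR 1 <= H by lra.
have H_genc : n.+1%:R * c <= H by lra.
have H2 : 2 <= H by lra.
have H0 : 0 < H by lra.
have cH7 : 7 <= c * H by rewrite mulrC -ler_pdivrMr.
have cH1 : 1 <= c * H by lra.
split.
  pose T := Num.truncn (c * H / 7).
  have T0 : (0 < T)%N by rewrite truncn_gt0 ler_pdivlMr ?mul1r.
  have TH : (7 * T)%:R <= c * H.
    rewrite natrM mulrC -ler_pdivlMr // truncn_le.
    by rewrite divr_ge0 // (le_trans ler01).
  have := num_sym_dep_pairs_ge n T0 TH; rewrite -(ler_nat R); apply: le_trans.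
  rewrite natrX -exprMn; apply: lerXn2r; rewrite ?nnegrE //.
    by rewrite mulr_ge0 ?divr_ge0 // ltW.
  by rewrite mulrAC ltW // truncnS_gt.
have := num_sym_dep_pairs_le n cH1; rewrite -(ler_nat R) => /le_trans; apply.
set h := Num.truncn (c * H).
have h0 : (0 < h)%N by rewrite truncn_gt0.
have hH : h%:R <= c * H by rewrite truncn_le (le_trans ler01).
have lnH1 : 1 <= ln H.
  by rewrite -[leLHS](expRK 1) ler_ln ?posrE ?expR_gt0.
set t := ((n.+1 * n.+1 * h ^ 2) ^ n.+1)%N.
have lnt : ln t%:R <= 4 * n.+1%:R * ln H.
  have -> : 4 * n.+1%:R * ln H = ln (H ^+ (4 * n.+1)).
    by rewrite lnXn // -natrM mulr_natl.
  rewrite ler_ln ?posrE ?exprn_gt0 ?ltr0n ?(muln_gt0, expn_gt0) ?h0 //.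
  rewrite /t natrX exprM; apply: lerXn2r;
    rewrite ?nnegrE ?exprn_ge0 ?(ltW H0) //.
  have -> : (n.+1 * n.+1 * h ^ 2)%:R = (n.+1%:R * h%:R) ^+ 2 :> R.
    by rewrite -natrM -natrX expnMn -!mulnn.
  rewrite (exprM H 2 2); apply: lerXn2r;
    rewrite ?nnegrE ?exprn_ge0 ?mulr_ge0 ?(ltW H0) //.
  by rewrite (le_trans (ler_wpM2l _ hH)) // mulrA expr2 ler_wpM2r // ltW.
set K := squares_bound _ _ _.
have Kle : K.+1%:R <= (1 + 4 * n.+1%:R / g) * ln H.
  have : K%:R <= ln t%:R / g.
    rewrite truncn_le divr_ge0 ?(ltW g0) // ln_ge0 // ler1n.
    by rewrite !(muln_gt0, expn_gt0) h0.
  have : ln t%:R / g <= 4 * n.+1%:R * ln H / g by rewrite ler_pM2r ?invr_gt0.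
  rewrite -[K.+1%:R]natr1.
  have -> : 4 * n.+1%:R * ln H / g = 4 * n.+1%:R / g * ln H.
    by rewrite mulrAC.
  lra.
rewrite !natrM !natrX mulnn.
have -> : (3 * c) ^+ (n.+1 ^ 2) * 2 ^+ n.+1 * (1 + 4 * n.+1%:R / g) *
    H ^+ (n.+1 ^ 2) * ln H ^+ (2 + n.+1) =
  (3 * c * H) ^+ (n.+1 ^ 2) * 2 ^+ n.+1 *
    ((1 + 4 * n.+1%:R / g) * ln H ^+ (2 + n.+1)).
  by rewrite [X in _ = X * _ * _]exprMn; ring.
have f0 : 0 <= 1 + 4 * n.+1%:R / g.
  by rewrite addr_ge0 // divr_ge0 ?mulr_ge0 ?ltW.
apply: ler_pM; rewrite ?mulr_ge0 ?exprn_ge0 //.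
  rewrite ler_wpM2r ?exprn_ge0 //.
  apply: lerXn2r; rewrite ?nnegrE //; first by lra.
  rewrite -natr1 natrM; lra.
rewrite (le_trans Kle) // ler_wpM2l // exprS ler_peMr ?exprn_ege1 //.
by rewrite (le_trans ler01).
Qed.
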